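(* Let $d\ge3$, let $G=(V,E)$ be a finite undirected $d$-regular graph (each vertex has degree $d$) with $n=|V|$ vertices, let $W=A(G)/d$ where $A(G)$ is the adjacency matrix of $G$, and let $\tilde\gamma$ be the absolute spectral gap of $W$. Let $\xi=(\xi_v)_{v\in V}$ be any family of real initial observations, $\bar\xi=\frac1n\sum_{v}\xi_v$, and let $x^t=(x^t_v)_{v\in V}$ be the sequence of outputs of the message passing algorithm on $G$. (1) If $\tilde\gamma<1-2\sqrt{d-1}/d$, then $$\limsup_{t\to\infty}\Vert x^t-\bar\xi\,\mathbf 1\Vert_2^{1/t}\ \le\ \frac{(1-\tilde\gamma)+\sqrt{(1-\tilde\gamma)^2-4(d-1)/d^2}}{1+\sqrt{1-4(d-1)/d^2}}.$$ Moreover, the upper bound is reached (equality holds) if there exists an eigenvector $u$ corresponding to an eigenvalue of $W$ of magnitude $1-\tilde\gamma$ such that $\langle u,\xi\rangle\ne0$. (2) If $\tilde\gamma\ge1-2\sqrt{d-1}/d$, then $$\limsup_{t\to\infty}\Vert x^t-\bar\xi\,\mathbf 1\Vert_2^{1/t}\ \le\ \frac{2\sqrt{d-1}/d}{1+\sqrt{1-4(d-1)/d^2}}.$$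
   Context: Absolute spectral gap: if $1=\lambda_1\ge\lambda_2\ge\dots\ge\lambda_n$ are the eigenvalues of the symmetric stochastic matrix $W$ ($\lambda_1=1$ corresponding to the all-ones vector $\mathbf 1$), then $\tilde\gamma=\min(1-\lambda_2,\lambda_n+1)$. Message passing algorithm on $G$ ($\mathcal N(v)$ denotes the set of neighbors of $v$): for each ordered pair $(v,w)$ of adjacent vertices set $K^0_{vw}=0$, $M^0_{vw}=0$ and $$K^{t+1}_{vw}=1+\sum_{u\in\mathcal N(v),\,u\ne w}K^t_{uv},\qquad M^{t+1}_{vw}=\frac{1}{K^{t+1}_{vw}}\Big(\xi_v+\sum_{u\in\mathcal N(v),\,u\ne w}K^t_{uv}M^t_{uv}\Big).$$ The output at time $t$ is $$x^t_v=\frac{\xi_v+\sum_{u\in\mathcal N(v)}K^t_{uv}M^t_{uv}}{1+\sum_{u\in\mathcal N(v)}K^t_{uv}}.$$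
   Formalization: In the ''moreover'' clause, when the absolute spectral gap is 0 (G disconnected or bipartite), the eigenvector u is also required to be orthogonal to the all-ones vector; otherwise u = ξ = 1 gives limsup 0 while the bound is 1. *)

(* Defs.v *)
From HB Require Import structures.
From mathcomp Require Import all_boot all_order all_algebra.
From mathcomp Require Import all_classical all_reals all_analysis.
From mathcomp Require polyrcf.

Set Implicit Arguments.
Unset Strict Implicit.
Unset Printing Implicit Defensive.

Import Order.TTheory GRing.Theory Num.Theory.

Local Open Scope ring_scope.

Definition simple_graph (V : finType) (e : rel V) :=
  symmetric e /\ irreflexive e.

Definition neighbors (V : finType) (e : rel V) (v : V) : {set V} :=
  [set u | e v u].

Definition regular_graph (V : finType) (e : rel V) (d : nat) :=
  forall v, #|neighbors e v| = d.

(* Vertices index rows and columns through [enum_val]. *)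
Definition adjacency_mx (R : realType) (V : finType) (e : rel V) :
    'M[R]_#|V| :=
  \matrix_(i, j) (e (enum_val i) (enum_val j))%:R.

Definition transition_mx (R : realType) (V : finType) (e : rel V) (d : nat) :
    'M[R]_#|V| :=
  d%:R^-1 *: adjacency_mx R e.

(* The real eigenvalues in nonincreasing order, repeated according to their
   algebraic multiplicity; for a symmetric matrix this lists all n of them. *)
Definition eigenvalues (R : realType) (n : nat) (W : 'M[R]_n) : seq R :=
  sort >=%R
    (flatten [seq nseq (mup a (char_poly W)) a
             | a <- polyrcf.rootsR (char_poly W)]).

(* min(1 - lambda_2, lambda_n + 1); the sequence is numbered from 0. *)
Definition abs_spectral_gap (R : realType) (n : nat) (W : 'M[R]_n) : R :=
  Num.min (1 - (eigenvalues W)`_1) ((eigenvalues W)`_n.-1 + 1).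

Section MessagePassing.
Variables (R : realType) (V : finType) (e : rel V) (xi : V -> R).

(* The recursions are written for all pairs (v, w), but the messages on
   adjacent pairs only depend on messages on adjacent pairs. *)
Fixpoint mp_K (t : nat) (v w : V) : R :=
  if t is t'.+1 then
    1 + \sum_(u in neighbors e v | u != w) mp_K t' u v
  else 0.

Fixpoint mp_M (t : nat) (v w : V) : R :=
  if t is t'.+1 then
    (mp_K t'.+1 v w)^-1 *
      (xi v + \sum_(u in neighbors e v | u != w) mp_K t' u v * mp_M t' u v)
  else 0.

Definition mp_output (t : nat) (v : V) : R :=
  (xi v + \sum_(u in neighbors e v) mp_K t u v * mp_M t u v)
  / (1 + \sum_(u in neighbors e v) mp_K t u v).

Definition mean : R := (#|V|%:R)^-1 * \sum_v xi v.

End MessagePassing.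

Definition norm2 (R : realType) (V : finType) (x : V -> R) : R :=
  Num.sqrt (\sum_v x v ^+ 2).

(* limsup of ||x^t - mean xi||_2 ^ (1/t), valued in the extended reals so that
   it is meaningful without a boundedness assumption. *)
Definition mp_rate (R : realType) (V : finType) (e : rel V) (xi : V -> R) :
    \bar R :=
  limn_esup (fun t : nat =>
    (norm2 (fun v => mp_output e xi t v - mean xi) `^ (t%:R^-1))%:E).

(* Main.v *)
(* The numerators [y] of the outputs satisfy the linear recurrence
   [y_(t+2) = A y_(t+1) - (d-1) y_t], with [y_1 = (1 + A) y_0] and [A = d W], and
   the denominators are scalars [D_t] between [(d-1)^t] and [3 (d-1)^t] obeying
   the same recurrence along the constants; hence so does [z_t = y_t - D_t mean xi],
   whose initial value has zero sum. Diagonalizing the symmetric matrix [W] splits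
   it into scalar recurrences [c_(t+2) = d a c_(t+1) - (d-1) c_t], one for each
   eigenvalue [a], and only those with [|a| <= 1 - gap] matter. For [|a| <= mu] and
   [mu >= 2 sqrt(d-1)/d] the solutions are at most [B (t+1) rho^t], where [rho] is
   the larger root of [X^2 - d mu X + (d-1)]; take [mu = 1 - gap], respectively
   [mu = 2 sqrt(d-1)/d]. When [|a| = mu = 1 - gap] the component along [u] starts
   with a nonzero coefficient on the larger root, so the rate is attained. *)
Require Import Defs.
From mathcomp Require Import all_boot all_order all_algebra.
From mathcomp Require Import all_classical all_reals all_analysis.
From mathcomp Require Import ring lra.
From mathcomp Require Import spectral mxred.
From mathcomp Require Import complex.
From mathcomp Require polyrcf.

Set Implicit Arguments.
Unset Strict Implicit.
Unset Printing Implicit Defensive.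

Import Order.TTheory GRing.Theory Num.Theory.
Local Open Scope ring_scope.

(** * Second order scalar recurrences *)

(** The larger root of [X^2 - b X + k] when [4 * k <= b ^+ 2]. *)
Definition dom_root (R : rcfType) (k b : R) : R :=
  (b + Num.sqrt (b ^+ 2 - 4 * k)) / 2.

(** After division by [rho ^+ t] each step adds at most [B / rho], so growth is linear; the forcing
    has the same rate as the recursion, whence the factor [t.+1]. *)
Lemma perturbed_geometric_bound (R : realFieldType) (rho B : R) (c : nat -> R) :
  0 < rho -> 0 <= B -> (forall t, `|c t.+1| <= rho * `|c t| + B * rho ^+ t) ->
  forall t, `|c t| <= (`|c 0| + B / rho) * t.+1%:R * rho ^+ t.
Proof.
move=> rho0 B0 step; elim=> [|t IH].
  by rewrite expr0 !mulr1 lerDl divr_ge0 // ltW.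
apply: le_trans (step t) _.
have -> : (`|c 0| + B / rho) * t.+2%:R * rho ^+ t.+1 =
    rho * ((`|c 0| + B / rho) * t.+1%:R * rho ^+ t) + B * rho ^+ t
    + rho ^+ t.+1 * `|c 0|.
  by rewrite -(natr1 t.+1) exprS; field; rewrite gt_eqF.
rewrite -[leLHS]addr0 lerD // ?lerD2r ?ler_pM2l //.
by rewrite mulr_ge0 // exprn_ge0 // ltW.
Qed.

Section Recurrence.
Variables (R : rcfType) (k b : R).
Hypotheses (k_gt0 : 0 < k) (b_ge0 : 0 <= b) (disc_ge0 : 4 * k <= b ^+ 2).
Let rho := dom_root k b.

Lemma dom_root_gt0 : 0 < rho.
Proof.
rewrite divr_gt0 // ltr_wpDr ?sqrtr_ge0 // lt_neqAle b_ge0 andbT.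
by apply: contraTneq disc_ge0 => <-; rewrite expr0n /= -ltNge mulr_gt0.
Qed.

Lemma dom_root_eq : rho ^+ 2 = b * rho - k.
Proof.
have h : Num.sqrt (b ^+ 2 - 4 * k) ^+ 2 = b ^+ 2 - 4 * k.
  by rewrite sqr_sqrtr // subr_ge0.
rewrite /rho /dom_root.
by move: h; set s := Num.sqrt _ => h; field: h.
Qed.

Lemma dom_root_sqr_ge : k <= rho ^+ 2.
Proof.
have b2 : b / 2 <= rho by rewrite ler_pM2r ?invr_gt0 // lerDl sqrtr_ge0.
have h : (b / 2) ^+ 2 <= rho ^+ 2.
  by apply: lerXn2r => //; rewrite nnegrE ?(ltW dom_root_gt0) // divr_ge0.
by move: h; rewrite expr_div_n; have := disc_ge0; lra.
Qed.

(** Subtracting [p * c t] for a suitable [p] with [|p| <= rho] lowers the order by one: the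
    remainder is at most a multiple of [rho ^+ t], and [perturbed_geometric_bound] applies. *)
Lemma recurrence_bound (a : R) (c : nat -> R) :
  `|a| <= b -> (forall t, c t.+2 = a * c t.+1 - k * c t) ->
  exists B, forall t, `|c t| <= B * t.+1%:R * rho ^+ t.
Proof.
move=> ab rec; have rho0 := dom_root_gt0.
have a2b2 : a ^+ 2 <= b ^+ 2 by rewrite -(real_normK (num_real a)) ler_sqr ?nnegrE.
suff [p [B [B0 p_le step]]] : exists p B : R,
    [/\ 0 <= B, `|p| <= rho & forall t, `|c t.+1 - p * c t| <= B * rho ^+ t].
  exists (`|c 0| + B / rho); apply: perturbed_geometric_bound => // t.
  rewrite -[X in `|X|](subrK (p * c t)) addrC.
  rewrite (le_trans (ler_normD _ _)) // lerD // normrM ler_wpM2r //.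
have [le_disc|lt_disc] := leP (a ^+ 2) (4 * k).
(* Complex or double roots: the form [E] is multiplied by [k] at each step. Completing the square
   gives [E t = (c t.+1 - a / 2 * c t)^2 + (k - a^2 / 4) * (c t)^2] with both terms nonnegative, so
   [p = a / 2] works because [k <= rho ^+ 2]. *)
- pose E t := c t.+1 ^+ 2 - a * c t.+1 * c t + k * c t ^+ 2.
  have EE t : E t = E 0 * k ^+ t.
    elim: t => [|t IH]; first by rewrite expr0 mulr1.
    by rewrite exprS mulrCA -IH /E rec; ring.
  have sqE t : (c t.+1 - a / 2 * c t) ^+ 2 <= E t.
    have : 0 <= (k - (a / 2) ^+ 2) * c t ^+ 2.
      by rewrite mulr_ge0 ?sqr_ge0 // subr_ge0 expr_div_n; move: le_disc; lra.
    move=> h; rewrite -subr_ge0; apply: le_trans h _.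
    by rewrite le_eqVlt /E; apply/orP; left; apply/eqP; field.
  have E0 : 0 <= E 0 := le_trans (sqr_ge0 _) (sqE 0).
  exists (a / 2), (Num.sqrt (E 0)); split; first exact: sqrtr_ge0.
    rewrite normf_div (@ger0_norm _ 2) // ler_pM2r ?invr_gt0 //.
    by apply: le_trans ab _; rewrite lerDl sqrtr_ge0.
  move=> t; rewrite -ler_sqr ?nnegrE ?mulr_ge0 ?sqrtr_ge0 ?exprn_ge0 ?(ltW rho0) //.
  rewrite real_normK ?num_real // (le_trans (sqE t)) // EE.
  rewrite exprMn sqr_sqrtr // ler_wpM2l // exprAC.
  rewrite lerXn2r ?nnegrE ?exprn_ge0 ?(ltW k_gt0) ?(ltW rho0) //.
  exact: dom_root_sqr_ge.
(* Distinct real roots [(a + s) / 2] and [(a - s) / 2]: with [p] the first, the remainder is exactly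
   geometric with ratio the second. The sign [e] in [root_le] covers both. *)
set s := Num.sqrt (a ^+ 2 - 4 * k).
have s2 : s ^+ 2 = a ^+ 2 - 4 * k by rewrite sqr_sqrtr // subr_ge0 ltW.
have s0 : 0 <= s := sqrtr_ge0 _.
have as_le : (`|a| + s) / 2 <= rho.
  by rewrite ler_pM2r ?invr_gt0 // lerD // ler_sqrt ?lerD2r // subr_ge0.
have root_le e : `|e| = 1 -> `|(a + e * s) / 2| <= rho.
  move=> e1; rewrite normf_div (@ger0_norm _ 2) // (le_trans _ as_le) //.
  rewrite ler_pM2r ?invr_gt0 // (le_trans (ler_normD _ _)) // lerD2l normrM e1 mul1r.
  by rewrite ger0_norm.
exists ((a + 1 * s) / 2), `|c 1 - (a + 1 * s) / 2 * c 0|.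
split; first exact: normr_ge0.
  by apply: root_le; rewrite normr1.
elim=> [|t IH]; first by rewrite expr0 mulr1.
have -> : c t.+2 - (a + 1 * s) / 2 * c t.+1 =
    (a + -1 * s) / 2 * (c t.+1 - (a + 1 * s) / 2 * c t).
  by rewrite rec; field: s2.
by rewrite normrM exprS mulrCA ler_pM // root_le // normrN1.
Qed.

(** The initial condition puts weight [sg + rho] on the dominant root, where [sg] is the sign of
    [a]. Since [1 < rho], this stays positive even for [sg = -1]. *)
Lemma recurrence_lower_bound (a : R) (c : nat -> R) :
  1 < rho -> `|a| = b -> (forall t, c t.+2 = a * c t.+1 - k * c t) ->
  c 1 = (1 + a) * c 0 ->
  forall t, (rho - 1) / rho * `|c 0| * rho ^+ t <= `|c t|.
Proof.
move=> rho1 ab rec c1; have rho0 := dom_root_gt0.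
have [sg sg1 asg] : exists2 sg : R, sg * sg = 1 & a = sg * b.
  have [a0|a0] := leP 0 a; [exists 1|exists (-1)]; rewrite ?mulrNN ?mul1r //.
  - by rewrite -ab ger0_norm.
  - by rewrite -ab ltr0_norm // mulN1r opprK.
have nsg : `|sg| = 1.
  have : `|sg| ^+ 2 = 1 by rewrite -normrX expr2 sg1 normr1.
  by move/eqP; rewrite expr2 -expr2 sqrp_eq1 // => /eqP.
(* By Vieta, [rho'] is the other root of [X^2 - b X + k]; subtracting [rho' * w t] isolates the
   dominant component. *)
pose rho' := k / rho.
have rho'0 : 0 < rho' by rewrite divr_gt0.
have bE : b = rho + rho'.
  by rewrite /rho'; have := dom_root_eq => h; field: h; rewrite gt_eqF.
have kE : k = rho * rho' by rewrite /rho' mulrCA divff ?mulr1 // gt_eqF.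
clearbody rho'.
(* Multiplying by [c 0] and twisting by the sign of [a] makes [w] nonnegative. *)
pose w t := sg ^+ t * c t * c 0.
have w_rec t : w t.+2 = b * w t.+1 - k * w t.
  by rewrite /w rec asg !exprS; ring: sg1.
have w_step t : w t.+1 - rho' * w t = rho ^+ t * ((sg + rho) * c 0 ^+ 2).
  elim: t => [|t IH].
    by rewrite /w c1 asg bE !expr0 expr1; ring: sg1.
  have -> : w t.+2 - rho' * w t.+1 = rho * (w t.+1 - rho' * w t).
    by rewrite w_rec bE kE; ring.
  by rewrite IH (exprS rho) -[RHS]mulrA.
have sg_rho : rho - 1 <= sg + rho.
  by have : - 1 <= sg; [rewrite lerNnormlW ?nsg | lra].
have rhs0 t : 0 <= rho ^+ t * ((sg + rho) * c 0 ^+ 2).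
  rewrite mulr_ge0 ?exprn_ge0 ?(ltW rho0) // mulr_ge0 ?sqr_ge0 //.
  by apply: le_trans sg_rho; rewrite subr_ge0 ltW.
have w_ge0 : forall t, 0 <= w t.
  elim=> [|t IH]; first by rewrite /w expr0 mul1r -expr2 sqr_ge0.
  rewrite -(subrK (rho' * w t) (w t.+1)) w_step addr_ge0 // mulr_ge0 // ltW //.
have w_norm t : w t = `|c t| * `|c 0|.
  by rewrite -(ger0_norm (w_ge0 t)) !normrM normrX nsg expr1n mul1r.
move=> t; have [->|c00] := eqVneq (c 0) 0; first by rewrite normr0 mulr0 mul0r.
have nc0 : 0 < `|c 0| by rewrite normr_gt0.
(* [w_step] only bounds [w] at successors, so index 0 is separate. The division by [rho] in the
   constant pays for the shift from [rho ^+ t] to [rho ^+ t.+1]. *)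
case: t => [|t].
  rewrite expr0 mulr1 ler_piMl // ler_pdivrMr // mul1r gerBl //.
rewrite -(ler_pM2r nc0) -w_norm -(subrK (rho' * w t) (w t.+1)) w_step.
rewrite ler_wpDr ?(mulr_ge0 (ltW rho'0) (w_ge0 t)) //.
have -> : (rho - 1) / rho * `|c 0| * rho ^+ t.+1 * `|c 0| =
    rho ^+ t * ((rho - 1) * `|c 0| ^+ 2).
  by rewrite exprS; field; rewrite gt_eqF.
rewrite real_normK ?num_real // ler_wpM2l ?exprn_ge0 ?(ltW rho0) //.
by rewrite ler_wpM2r ?sqr_ge0.
Qed.

End Recurrence.

(** * Spectrum of symmetric and stochastic matrices *)

(** The spectral theorem is applied over [R[i]], where [W] becomes Hermitian and its spectrum is
    real. Real matrices similar over [R[i]] are similar through a real matrix, which descends to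
    [R]. The rows of [P] are left eigenvectors. *)
Lemma symmetric_diagonalizable (R : rcfType) n (W : 'M[R]_n) : W^T = W ->
  exists (P : 'M[R]_n) (D : 'rV[R]_n), P \in unitmx /\ P *m W = diag_mx D *m P.
Proof.
move=> Wsym; pose toC : R -> complex.complex R := complex.real_complex_def (Phant R).
have toC_real a : toC a \is Num.real by apply/complex_realP; exists a.
pose Wc := map_mx toC W.
have Wc_real : Wc \is a mxOver Num.real by apply/mxOverP => i j; rewrite mxE.
have Wc_herm : Wc \is hermsymmx.
  apply: realsym_hermsym => //; apply/is_hermitianmxP => /=.
  by rewrite expr0 scale1r map_mx_id // map_trmx Wsym.
have Dc_real := hermitian_spectral_diag_real Wc_herm.
have /orthomx_spectralP Wc_eq := hermitian_normalmx Wc_herm.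
set Pc := spectralmx Wc in Wc_eq; set Dc := spectral_diag Wc in Wc_eq Dc_real.
have PcW : similar_in unitmx Wc (diag_mx Dc).
  exists Pc; first exact: spectral_unit.
  apply/similarP; first exact: spectral_unit.
  by rewrite {1}Wc_eq !mulmxA mulmxV ?mul1mx // spectral_unit.
have diag_real : diag_mx Dc \is a mxOver Num.real.
  apply/mxOverP => i j; rewrite mxE; case: eqP => _; rewrite ?mulr0n ?rpred0 //.
  by rewrite mulr1n (mxOverP Dc_real).
have [Q /andP[/= Q_real Q_unit] /(similarP Q_unit) QW] :=
  real_similar PcW Wc_real diag_real.
pose P := map_mx (@complex.Re R) Q; pose D := map_mx (@complex.Re R) Dc.
have toCRe m p (A : 'M[R[i]]_(m, p)) : A \is a mxOver Num.real ->
    map_mx toC (map_mx (@complex.Re R) A) = A.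
  by move=> /mxOverP AR; apply/matrixP => i j; rewrite !mxE; exact: RRe_real.
exists P, D; split.
  by rewrite -(map_unitmx (complex.real_complex R)) (toCRe _ _ Q).
apply: (@map_mx_inj _ _ (complex.real_complex R)).
by rewrite !map_mxM map_diag_mx (toCRe _ _ Q) // (toCRe _ _ Dc).
Qed.

Lemma char_poly_diag (R : comNzRingType) n (D : 'rV[R]_n) :
  char_poly (diag_mx D) = \prod_i ('X - (D 0 i)%:P).
Proof.
rewrite char_poly_trig ?diag_mx_is_trig //.
by apply: eq_bigr => i _; rewrite mxE eqxx mulr1n.
Qed.

Lemma char_poly_similar (F : fieldType) n (P A B : 'M[F]_n) :
  P \in unitmx -> P *m A = B *m P -> char_poly A = char_poly B.
Proof.
move=> Pu PA.
have PC0 : \det (map_mx polyC P) != 0.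
  by rewrite det_map_mx polyC_eq0 -unitfE -unitmxE.
apply: (mulfI PC0); rewrite /char_poly -det_mulmx mulrC -det_mulmx; congr (\det _).
rewrite /char_poly_mx mulmxBr mulmxBl -!map_mxM PA.
by congr (_ - _); rewrite scalar_mxC.
Qed.

Lemma mup_prod_XsubC (R : fieldType) (s : seq R) a :
  mup a (\prod_(b <- s) ('X - b%:P)) = count_mem a s.
Proof.
elim: s => [|b s IH]; first by rewrite big_nil mupNroot // root1.
have s0 : \prod_(c <- s) ('X - c%:P) != 0.
  by rewrite monic_neq0 // monic_prod_XsubC.
rewrite big_cons mupM ?polyXsubC_eq0 // IH.
by have := mup_XsubCX 1 a b; rewrite expr1 => -> /=; rewrite eq_sym; case: eqP.
Qed.

(** Counts are compared: a root [a] occurs only in its own block, whose length [mup a] is its number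
    of occurrences in [s]. *)
Lemma eigenvalues_perm (R : realType) n (W : 'M[R]_n) (s : seq R) :
  char_poly W = \prod_(b <- s) ('X - b%:P) -> perm_eq (eigenvalues W) s.
Proof.
move=> Ws; rewrite /eigenvalues perm_sort; apply/allP => a _ /=.
set p := char_poly W; have p0 : p != 0 by rewrite monic_neq0 // char_poly_monic.
have mupE b : mup b p = count_mem b s by rewrite /p Ws mup_prod_XsubC.
have memE b : (b \in polyrcf.rootsR p) = (b \in s).
  have := polyrcf.roots_on_rootsR p0 b; rewrite in_itv /= => <-.
  by rewrite /p Ws root_prod_XsubC.
have uniqr : uniq (polyrcf.rootsR p) by apply: polyrcf.uniq_roots.
apply/eqP; rewrite count_flatten -map_comp.
rewrite (eq_map (g := fun b => (count_mem b s * (b == a))%N)); last first.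
  by move=> b /=; rewrite count_nseq mupE /= mulnC.
rewrite sumnE big_map.
have [ar|ar] := boolP (a \in polyrcf.rootsR p).
  rewrite (bigD1_seq a) //= eqxx muln1 big1 ?addn0 // => b /negbTE ->.
  by rewrite muln0.
rewrite big1_seq ?(count_memPn _) -?memE //.
move=> b /= br; case: eqP => [eb|_]; last by rewrite muln0.
by rewrite eb (negbTE ar) in br.
Qed.

Lemma sorted_ge_second (R : realDomainType) (s : seq R) (a : R) :
  sorted >=%R s -> (1 < count (>= a) s)%N -> a <= s`_1.
Proof.
case: s => [|x0 [|x1 s]] //=; first by rewrite addn0; case: (a <= x0).
move=> /andP[_ x1s]; apply: contraLR; rewrite -ltNge => x1a.
have s_lt : count (>= a) s = 0%N.
  apply/eqP; rewrite -leqn0 leqNgt -has_count -all_predC.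
  have := order_path_min (rev_trans le_trans) x1s.
  by apply: sub_all => y yx1 /=; rewrite -ltNge (le_lt_trans yx1).
by rewrite s_lt addn0 (leNgt a x1) x1a addn0 -leqNgt; case: (a <= x0).
Qed.

Lemma sorted_ge_last (R : realDomainType) (s : seq R) (x : R) :
  sorted >=%R s -> x \in s -> s`_(size s).-1 <= x.
Proof.
move=> s_sorted xs; rewrite -(nth_index 0 xs).
have lt_s : (index x s < size s)%N by rewrite index_mem.
apply: (sorted_leq_nth (rev_trans le_trans) (lexx : reflexive >=%R)) => //.
- by rewrite inE prednK // (leq_ltn_trans _ lt_s).
- by rewrite -ltnS prednK // (leq_ltn_trans _ lt_s).
Qed.

Section StochasticSpectrum.
Variables (R : realType) (n : nat) (W P : 'M[R]_n) (D : 'rV[R]_n).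
Hypotheses (W_ge0 : forall i j, 0 <= W i j)
  (W_sum : W *m const_mx 1 = const_mx 1 :> 'cV_n)
  (P_unit : P \in unitmx) (PW : P *m W = diag_mx D *m P).

(** [row i P] is a left eigenvector, nonzero because [P] is invertible, and multiplication by a
    nonnegative matrix with unit row sums does not increase the l1 norm. *)
Lemma stochastic_eigenvalue_le1 i : `|D 0 i| <= 1.
Proof.
pose u := row i P; have uW : u *m W = D 0 i *: u.
  by apply/rowP => j; rewrite -row_mul PW mul_diag_mx !mxE.
have S_gt0 : 0 < \sum_j `|u 0 j|.
  rewrite lt_neqAle sumr_ge0 ?andbT // eq_sym.
  apply: contraTneq (P_unit) => /eqP; rewrite psumr_eq0 // => /allP u0.
  have Pi0 : row i P = 0.
    apply/rowP => j; rewrite [RHS]mxE; apply/eqP.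
    by rewrite -normr_eq0 (implyP (u0 j _)) ?mem_index_enum.
  rewrite unitmxE unitfE (expand_det_row _ i) big1 ?eqxx // => j _.
  by have /rowP/(_ j) := Pi0; rewrite !mxE => ->; rewrite mul0r.
have Wsum1 k : \sum_j W k j = 1.
  have /colP/(_ k) := W_sum; rewrite !mxE => <-.
  by apply: eq_bigr => j _; rewrite mxE mulr1.
rewrite -(ler_pM2r S_gt0) mul1r mulr_sumr.
have -> : \sum_j `|u 0 j| = \sum_j \sum_k `|u 0 k| * W k j.
  by rewrite exchange_big; apply: eq_bigr => k _; rewrite -mulr_sumr Wsum1 mulr1.
apply: ler_sum => j _; have /rowP/(_ j) := uW; rewrite !mxE -normrM => <-.
apply: le_trans (ler_norm_sum _ _ _) _.
by apply: ler_sum => k _; rewrite normrM (ger0_norm (W_ge0 _ _)) mxE.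
Qed.

Lemma char_poly_diagonalization :
  char_poly W = \prod_(b <- [seq D 0 i | i <- enum 'I_n]) ('X - b%:P).
Proof.
by rewrite (char_poly_similar P_unit PW) char_poly_diag big_map big_enum.
Qed.

(* Only the coordinate along a simple dominant eigenvalue can escape the bound,
   and it vanishes on vectors of zero sum. *)
Lemma eigenvalue_gap_or_coord0 (z : 'rV[R]_n) : z *m (const_mx 1 : 'cV_n) = 0 ->
  forall i, `|D 0 i| <= 1 - abs_spectral_gap W \/ (z *m invmx P) 0 i = 0.
Proof.
move=> z1 i; pose l := eigenvalues W.
have l_perm := eigenvalues_perm char_poly_diagonalization.
have l_sorted : sorted >=%R l by apply: sort_sorted => x y; exact: le_total.
have l_size : size l = n by rewrite (perm_size l_perm) size_map size_enum_ord.
have last_le : l`_n.-1 <= D 0 i.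
  rewrite -{1}l_size sorted_ge_last // (perm_mem l_perm) map_f //.
  by rewrite mem_enum.
have [[j ji Dij]|nlt] := pselect (exists2 j, j != i & D 0 i <= D 0 j).
  left; have le2 : D 0 i <= l`_1.
    apply: sorted_ge_second => //; have /permP -> := l_perm.
    rewrite count_map enumT.
    have /card_gt1P : exists x y : 'I_n, [/\ x \in [pred k | D 0 i <= D 0 k],
      y \in [pred k | D 0 i <= D 0 k] & x != y] by exists j, i; rewrite !inE.
    by rewrite cardE /enum_mem size_filter.
  have gap1 : abs_spectral_gap W <= 1 - l`_1 by rewrite ge_min lexx.
  have gap2 : abs_spectral_gap W <= l`_n.-1 + 1 by rewrite ge_min lexx orbT.
  by rewrite ler_norml; apply/andP; split; lra.
(* Otherwise [D 0 i] is strictly maximal. As [diag_mx D] fixes [g], and every other eigenvalue is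
   below 1, [g] is supported at [i]. The zero sum of [z] then reads as coordinate [i] times [g i 0],
   and [g i 0 = 0] would make the all-ones vector vanish. *)
right; pose g : 'cV[R]_n := P *m const_mx 1.
have Dg j : (D 0 j - 1) * g j 0 = 0.
  have : diag_mx D *m g = g by rewrite mulmxA -PW -mulmxA W_sum.
  by move=> /colP/(_ j); rewrite mul_diag_mx mxE mulrBl mul1r => ->; rewrite subrr.
have g_neq j : j != i -> g j 0 = 0.
  move=> ji; have /eqP := Dg j; rewrite mulf_eq0 => /orP[|/eqP//].
  rewrite subr_eq0 => /eqP Dj1; case: nlt; exists j => //.
  by rewrite Dj1 (le_trans (ler_norm _)) // stochastic_eigenvalue_le1.
have cg : (z *m invmx P) 0 i * g i 0 = 0.
  have : z *m invmx P *m g = 0 by rewrite /g mulmxA mulmxKV.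
  move=> /matrixP/(_ 0 0); rewrite mxE (bigD1 i) //= big1 ?addr0 ?mxE //.
  by move=> j /g_neq ->; rewrite mulr0.
have /eqP := cg; rewrite mulf_eq0 => /orP[/eqP//|/eqP gi0].
have g0 : g = 0.
  apply/colP => j; rewrite [RHS]mxE.
  by have [->//|/g_neq] := eqVneq j i.
have : invmx P *m g = const_mx 1 by rewrite mulKmx.
by rewrite g0 mulmx0 => /colP/(_ i); rewrite !mxE => /esym/eqP; rewrite oner_eq0.
Qed.

End StochasticSpectrum.

(** * Recurrences for the messages *)

Section MessagePassingRecurrence.
Variables (R : realType) (V : finType) (e : rel V) (d : nat) (xi : V -> R).
Hypotheses (e_sym : symmetric e) (e_reg : regular_graph e d).

(** [N] and [y] clear the denominators of messages and outputs, which makes the recursion linear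
    with constant coefficients. *)
Let N t u v : R := mp_K R e t u v * mp_M e xi t u v.
Let y t v : R := xi v + \sum_(u in neighbors e v) N t u v.

Lemma mp_K_ge0 t v w : 0 <= mp_K R e t v w.
Proof. by elim: t v w => [|t IH] v w //=; rewrite addr_ge0 ?sumr_ge0. Qed.

Lemma neighborsE u v : (u \in neighbors e v) = e v u.
Proof. by rewrite inE. Qed.

Fixpoint msg_weight (t : nat) : R :=
  if t is t'.+1 then 1 + (d%:R - 1) * msg_weight t' else 0.

Lemma sum_neighbors_const v (c : R) : \sum_(u in neighbors e v) c = d%:R * c.
Proof. by rewrite sumr_const e_reg mulr_natl. Qed.

Lemma sum_neighborsD1 v w (F : V -> R) : e v w ->
  \sum_(u in neighbors e v) F u = F w + \sum_(u in neighbors e v | u != w) F u.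
Proof. by move=> vw; rewrite (bigD1 w) ?neighborsE. Qed.

Lemma mp_KE t v w : e v w -> mp_K R e t v w = msg_weight t.
Proof.
elim: t v w => [//|t IH] v w vw /=; congr (1 + _).
rewrite (eq_bigr (fun=> msg_weight t)); last first.
  by move=> u /andP[]; rewrite neighborsE => vu _; rewrite IH // e_sym.
have := sum_neighborsD1 (fun=> msg_weight t) vw.
by rewrite sum_neighbors_const => /esym/(canRL (addKr _)) ->; ring.
Qed.

(** The number of vertices in a ball of radius [t] of the [d]-regular tree. *)
Definition mp_denom t : R := 1 + d%:R * msg_weight t.

Lemma mp_denomE t v : 1 + \sum_(u in neighbors e v) mp_K R e t u v = mp_denom t.
Proof.
rewrite /mp_denom -(sum_neighbors_const v); congr (1 + _); apply: eq_bigr => u.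
by rewrite neighborsE => vu; rewrite mp_KE // e_sym.
Qed.

Lemma mp_denom0 : mp_denom 0 = 1.
Proof. by rewrite /mp_denom /= mulr0 addr0. Qed.

Lemma mp_denomS t : mp_denom t.+1 = (d%:R - 1) * mp_denom t + 2.
Proof. by rewrite /mp_denom /=; ring. Qed.

Lemma mp_NS t v w :
  N t.+1 v w = xi v + \sum_(u in neighbors e v | u != w) N t u v.
Proof.
rewrite /N [mp_M _ _ _ _ _]/= mulrA divff ?mul1r //.
rewrite gt_eqF //= ltr_pwDl // sumr_ge0 // => u _; exact: mp_K_ge0.
Qed.

Lemma mp_N_reverse t v w : e v w -> N t.+1 v w = y t v - N t w v.
Proof. by move=> vw; rewrite mp_NS /y (sum_neighborsD1 _ vw); ring. Qed.

Lemma mp_num0 v : y 0 v = xi v.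
Proof. by rewrite /y big1 ?addr0 // => u _; rewrite /N mul0r. Qed.

Lemma mp_num1 v : y 1 v = xi v + \sum_(u in neighbors e v) y 0 u.
Proof.
rewrite /y; congr (_ + _); apply: eq_bigr => u; rewrite neighborsE => vu.
by rewrite mp_N_reverse 1?e_sym // [N 0 _ _]mul0r subr0.
Qed.

(** Reversing messages twice brings back [N t u v]. The [d] neighbours contribute [- d * y t v], and
    the returning messages restore one copy of [y t v] and cancel [xi v]. *)
Lemma mp_numSS t v :
  y t.+2 v = \sum_(u in neighbors e v) y t.+1 u - (d%:R - 1) * y t v.
Proof.
rewrite {1}/y (eq_bigr (fun u => y t.+1 u - (y t v - N t u v))); last first.
  move=> u; rewrite neighborsE => vu.
  by rewrite mp_N_reverse 1?e_sym // mp_N_reverse.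
rewrite !sumrB sum_neighbors_const.
have -> : \sum_(u in neighbors e v) N t u v = y t v - xi v by rewrite /y addrC addKr.
ring.
Qed.

Lemma mp_outputE t v : mp_output e xi t v = y t v / mp_denom t.
Proof. by rewrite -(mp_denomE t v). Qed.

End MessagePassingRecurrence.

(** * Growth of the denominators *)

Section DenominatorBounds.
Variables (R : realType) (d : nat).
Hypothesis d_ge3 : (3 <= d)%N.
Let d3 : 3 <= d%:R :> R.
Proof. by rewrite ler_nat. Qed.

Lemma mp_denom_ge t : (d%:R - 1) ^+ t <= mp_denom R d t.
Proof.
elim: t => [|t IH]; first by rewrite mp_denom0 expr0.
rewrite mp_denomS exprS ler_wpDr // ler_wpM2l //; have := d3; lra.
Qed.

(** The summand 2 strengthens the induction: it absorbs the inhomogeneous term because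
    [2 * (d - 1) >= 4]. *)
Lemma mp_denom_le t : mp_denom R d t + 2 <= 3 * (d%:R - 1) ^+ t.
Proof.
elim: t => [|t IH]; first by rewrite mp_denom0 expr0; lra.
rewrite mp_denomS exprS mulrCA.
apply: le_trans (_ : (d%:R - 1) * (mp_denom R d t + 2) <= _).
  by have := d3; lra.
by rewrite ler_wpM2l //; have := d3; lra.
Qed.

End DenominatorBounds.

(** * Limits superior of roots *)

Section RootAsymptotics.
Local Open Scope classical_set_scope.

Lemma limn_esup_le_near (R : realType) (u : nat -> \bar R) (l : \bar R) :
  (\forall t \near \oo, u t <= l)%E -> (limn_esup u <= l)%E.
Proof.
move=> ul.
apply: (@le_trans _ _ (ereal_sup [set u t | t in [set t | (u t <= l)%E]])).
  by apply: ereal_inf_lbound; exists [set t | (u t <= l)%E]%classic.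
by apply: ge_ereal_sup => _ [t /= tl <-].
Qed.

Lemma le_limn_esup_near (R : realType) (u : nat -> \bar R) (l : \bar R) :
  (\forall t \near \oo, l <= u t)%E -> (l <= limn_esup u)%E.
Proof.
move=> lu; apply: le_ereal_inf_tmp => _ [A A_oo <-].
have [t [/= lt At]] : exists t, (l <= u t)%E /\ A t.
  by apply: (@filter_ex _ \oo); exact: filterI.
by apply: le_trans lt _; apply: ereal_sup_ubound; exists t.
Qed.

Lemma bernoulli (R : realDomainType) (x : R) t :
  0 <= x -> 1 + t%:R * x <= (1 + x) ^+ t.
Proof.
move=> x0; elim: t => [|t IH]; first by rewrite mul0r addr0 expr0.
rewrite exprS; apply: le_trans (_ : (1 + x) * (1 + t%:R * x) <= _).
  have : 0 <= t%:R * (x * x) by rewrite mulr_ge0 ?mulr_ge0.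
  by rewrite -natr1; lra.
by rewrite ler_wpM2l // addr_ge0.
Qed.

Lemma linear_le_geometric (R : realType) (B s : R) : 1 < s ->
  \forall t \near \oo, B * t.+1%:R <= s ^+ t.
Proof.
(* Bernoulli applied to the square root of [s] gives the quadratic lower bound [(1 + t x)^2] for
   [s ^+ t], which overtakes any linear function. *)
move=> s1; pose x := Num.sqrt s - 1.
have x0 : 0 < x by rewrite subr_gt0 -sqrtr1 ltr_sqrt // (lt_trans _ s1).
have sE : s = (1 + x) ^+ 2 by rewrite addrC subrK sqr_sqrtr // ltW // (lt_trans _ s1).
clearbody x; have x2 : 0 < x ^+ 2 by rewrite exprn_gt0.
exists (Num.bound (2 * `|B| / x ^+ 2)).+1 => // t /= t_gt.
have t1 : 1 <= t%:R :> R by rewrite ler1n (leq_trans _ t_gt).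
have tB : 2 * `|B| <= t%:R * x ^+ 2.
  rewrite -ler_pdivrMr // ltW // (lt_le_trans (archi_boundP _)) //.
    by rewrite divr_ge0 ?mulr_ge0 // ltW.
  by rewrite ler_nat ltnW.
apply: le_trans (_ : (1 + t%:R * x) ^+ 2 <= _); last first.
  rewrite sE exprAC; have x_ge0 := ltW x0.
  by apply: lerXn2r; rewrite ?nnegrE ?bernoulli ?exprn_ge0 ?addr_ge0 ?mulr_ge0.
have tx : 0 <= t%:R * x by rewrite mulr_ge0 // ltW.
have h1 : B * t.+1%:R <= `|B| * t.+1%:R by rewrite ler_wpM2r // ler_norm.
have h2 : `|B| * t.+1%:R <= t%:R * (2 * `|B|).
  by rewrite -natr1; have := ler_wpM2l (normr_ge0 B) t1; lra.
have h3 : t%:R * (2 * `|B|) <= t%:R * (t%:R * x ^+ 2) by rewrite ler_wpM2l.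
have -> : (1 + t%:R * x) ^+ 2 = 1 + 2 * (t%:R * x) + t%:R * (t%:R * x ^+ 2) by ring.
by lra.
Qed.

Lemma powR_inv_le (R : realType) (x y : R) t : (0 < t)%N -> 0 <= x -> 0 <= y ->
  (x `^ t%:R^-1 <= y) = (x <= y ^+ t).
Proof.
move=> t0 x0 y0.
have x_eq : (x `^ t%:R^-1) ^+ t = x.
  by rewrite -powR_mulrn ?powR_ge0 // -powRrM mulVf ?powRr1 // pnatr_eq0 -lt0n.
by rewrite -[in RHS]x_eq ler_pXn2r // nnegrE powR_ge0.
Qed.

Lemma le_powR_inv (R : realType) (x y : R) t : (0 < t)%N -> 0 <= x -> 0 <= y ->
  (y <= x `^ t%:R^-1) = (y ^+ t <= x).
Proof.
move=> t0 x0 y0.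
have x_eq : (x `^ t%:R^-1) ^+ t = x.
  by rewrite -powR_mulrn ?powR_ge0 // -powRrM mulVf ?powRr1 // pnatr_eq0 -lt0n.
by rewrite -[in RHS]x_eq ler_pXn2r // nnegrE powR_ge0.
Qed.

Lemma limn_esup_root_le (R : realType) (f : nat -> R) (B r : R) : 0 < r ->
  (forall t, 0 <= f t <= B * t.+1%:R * r ^+ t) ->
  (limn_esup (fun t => (f t `^ t%:R^-1)%:E) <= r%:E)%E.
Proof.
move=> r0 fB; apply/lee_addgt0Pr => eps eps0.
apply: limn_esup_le_near.
have s1 : 1 < (r + eps) / r by rewrite ltr_pdivlMr // mul1r ltrDl.
near=> t; have t_gt0 : (0 < t)%N by near: t; exists 1%N.
have /andP[f0 fle] := fB t.
rewrite -EFinD lee_fin powR_inv_le ?addr_ge0 ?(ltW r0) ?(ltW eps0) //.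
apply: le_trans fle _; rewrite -ler_pdivlMr ?exprn_gt0 // -expr_div_n.
near: t; exact: linear_le_geometric.
Unshelve. all: by end_near. Qed.

Lemma limn_esup_root_ge (R : realType) (f : nat -> R) (B r : R) :
  0 < B -> 0 < r -> (forall t, B * r ^+ t <= f t) ->
  (r%:E <= limn_esup (fun t => (f t `^ t%:R^-1)%:E))%E.
Proof.
move=> B0 r0 fB; apply/lee_subgt0Pr => eps eps0.
apply: le_limn_esup_near.
have f0 t : 0 <= f t.
  by rewrite (le_trans _ (fB t)) // mulr_ge0 ?exprn_ge0 ?(ltW B0) ?(ltW r0).
have [eps_ge|eps_lt] := leP r eps.
  near=> t; rewrite -EFinB lee_fin (le_trans _ (powR_ge0 _ _)) // subr_le0 //.
have s1 : 1 < r / (r - eps) by rewrite ltr_pdivlMr ?mul1r ?subr_gt0 // gtrBl.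
near=> t; have t_gt0 : (0 < t)%N by near: t; exists 1%N.
rewrite -EFinB lee_fin le_powR_inv // ?subr_ge0 ?(ltW eps_lt) //.
apply: le_trans (_ : B * r ^+ t <= _) => //.
rewrite -ler_pdivrMl // mulrC.
have t1 : 1 <= t.+1%:R :> R by rewrite ler1n.
rewrite -ler_pdivlMl ?exprn_gt0 ?subr_gt0 // mulrC -expr_div_n.
(* The factor [t.+1] only serves to bring the constant [B^-1] under [linear_le_geometric]. *)
apply: le_trans (_ : B^-1 * t.+1%:R <= _).
  by rewrite ler_peMr // invr_ge0 ltW.
near: t; exact: linear_le_geometric.
Unshelve. all: by end_near. Qed.

End RootAsymptotics.

(** * Deviation from the mean *)

Section Norm2.
Variables (R : realType) (V : finType).
Implicit Type f : V -> R.

Lemma norm2_ge0 f : 0 <= norm2 f.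
Proof. exact: sqrtr_ge0. Qed.

Lemma norm2_le_sum f : norm2 f <= \sum_v `|f v|.
Proof.
have S0 : 0 <= \sum_v `|f v| by rewrite sumr_ge0.
rewrite -(ger0_norm S0) -sqrtr_sqr ler_sqrt ?sqr_ge0 // expr2 mulr_sumr.
apply: ler_sum => v _; rewrite -(real_normK (num_real (f v))) expr2 ler_wpM2r //.
by rewrite (bigD1 v) //= lerDl sumr_ge0.
Qed.

Lemma norm_le_norm2 f v : `|f v| <= norm2 f.
Proof.
rewrite -sqrtr_sqr ler_sqrt; last by rewrite sumr_ge0 // => w _; rewrite sqr_ge0.
by rewrite (bigD1 v) //= lerDl sumr_ge0 // => w _; rewrite sqr_ge0.
Qed.

Lemma norm2Z f (c : R) : 0 <= c -> norm2 (fun v => f v * c) = norm2 f * c.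
Proof.
move=> c0; rewrite -[X in _ * X](ger0_norm c0) -sqrtr_sqr -sqrtrM; last first.
  by rewrite sumr_ge0 // => w _; rewrite sqr_ge0.
by rewrite mulr_suml; congr Num.sqrt; apply: eq_bigr => v _; rewrite exprMn.
Qed.

End Norm2.

Lemma sum_ord_card (R : nmodType) (V : finType) (F : 'I_#|V| -> R) :
  \sum_i F i = \sum_v F (enum_rank v).
Proof. by rewrite (reindex enum_rank) //; apply: onW_bij; exact: enum_rank_bij. Qed.

(** * The transition matrix of a regular graph *)

Section Transition.
Variables (R : realType) (V : finType) (e : rel V) (d : nat).
Hypotheses (e_sym : symmetric e) (e_reg : regular_graph e d) (d_gt0 : (0 < d)%N).
Let W := transition_mx R e d.
Let dR_neq0 : d%:R != 0 :> R. Proof. by rewrite pnatr_eq0 -lt0n. Qed.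

Lemma transition_mx_sym : W^T = W.
Proof. by apply/matrixP => i j; rewrite !mxE e_sym. Qed.

Lemma transition_mx_ge0 i j : 0 <= W i j.
Proof. by rewrite !mxE mulr_ge0 // invr_ge0. Qed.

Lemma mul_row_transition (f : V -> R) j :
  ((\row_i f (enum_val i)) *m W) 0 j =
  d%:R^-1 * \sum_(u in neighbors e (enum_val j)) f u.
Proof.
rewrite mxE sum_ord_card mulr_sumr [RHS]big_mkcond; apply: eq_bigr => u _.
rewrite !mxE enum_rankK inE e_sym.
by case: (e _ _); rewrite ?mulr0 // mulr1 mulrC.
Qed.

Lemma transition_mx_sum : W *m const_mx 1 = const_mx 1 :> 'cV_#|V|.
Proof.
apply: trmx_inj; rewrite trmx_mul transition_mx_sym trmx_const.
have <- : \row_i 1 = const_mx 1 :> 'rV[R]_#|V| by apply/rowP => i; rewrite !mxE.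
apply/rowP => j; rewrite (mul_row_transition (fun=> 1)) (sum_neighbors_const e_reg).
by rewrite mulr1 mulVf // mxE.
Qed.

End Transition.

(** * Spectral bounds for the deviation *)

Section Deviation.
Variables (R : realType) (V : finType) (e : rel V) (d : nat) (xi : V -> R).
Hypotheses (e_sym : symmetric e) (e_reg : regular_graph e d) (d_ge3 : (3 <= d)%N).
Let W := transition_mx R e d.
Let d_gt0 : (0 < d)%N. Proof. exact: leq_trans d_ge3. Qed.
Let d3 : 3 <= d%:R :> R. Proof. by rewrite ler_nat. Qed.
Let k : R := d%:R - 1.
Let k_gt0 : 0 < k. Proof. by rewrite /k; have := d3; lra. Qed.

(* Unnormalised error: it obeys the same recurrence as the numerators because
   the denominators obey it along the constants. *)
Definition deviation t v : R :=
  xi v + \sum_(u in neighbors e v) mp_K R e t u v * mp_M e xi t u v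
  - mp_denom R d t * mean xi.

Lemma deviation0 v : deviation 0 v = xi v - mean xi.
Proof. by rewrite /deviation mp_num0 mp_denom0 mul1r. Qed.

Lemma deviation1 v :
  deviation 1 v = deviation 0 v + \sum_(u in neighbors e v) deviation 0 u.
Proof.
rewrite {1}/deviation mp_num1 // mp_denomS mp_denom0 deviation0.
rewrite [X in _ = _ + X]sumrB (sum_neighbors_const e_reg) mp_denom0; ring.
Qed.

Lemma deviationSS t v :
  deviation t.+2 v =
  \sum_(u in neighbors e v) deviation t.+1 u - k * deviation t v.
Proof.
rewrite {1}/deviation (mp_numSS xi e_sym e_reg) sumrB (sum_neighbors_const e_reg).
by rewrite /deviation /k !mp_denomS; ring.
Qed.

Lemma sum_deviation0 : \sum_v deviation 0 v = 0.
Proof.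
under eq_bigr do rewrite deviation0.
rewrite sumrB sumr_const /mean -[_ *+ _]mulr_natl mulrA.
(* With no vertices the inverse of [#|V|] is 0 by convention, and all sums are empty. *)
have [V0|V0] := posnP #|V|; last by rewrite divff ?mul1r ?subrr // pnatr_eq0 -lt0n.
by rewrite V0 mul0r mul0r big1 ?subrr // => v _; have := fintype0 v; rewrite V0.
Qed.

Lemma mp_denom_gt0 t : 0 < mp_denom R d t.
Proof. by apply: lt_le_trans (mp_denom_ge R d_ge3 t); rewrite exprn_gt0. Qed.

Lemma norm2_error t :
  norm2 (fun v => mp_output e xi t v - mean xi) =
  norm2 (deviation t) / mp_denom R d t.
Proof.
rewrite -norm2Z ?invr_ge0 ?(ltW (mp_denom_gt0 t)) //; congr norm2.
apply/funext => v; rewrite (mp_outputE _ e_sym e_reg) /deviation.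
by rewrite mulrBl [_ * mean xi]mulrC mulfK // gt_eqF ?mp_denom_gt0.
Qed.

(** Pairing the deviation with a right eigenvector [w] of [W] turns the vector recurrence into a
    scalar one for [coord w]. *)
Let Z t : 'rV[R]_#|V| := \row_i deviation t (enum_val i).
Let coord (w : 'cV[R]_#|V|) t : R := (Z t *m w) 0 0.

Let Z1 : Z 1 = Z 0 + d%:R *: (Z 0 *m W).
Proof.
apply/rowP => j; rewrite [LHS]mxE deviation1 [RHS]mxE [X in _ = _ + X]mxE.
by rewrite mul_row_transition // mulrA divff ?mul1r ?mxE // pnatr_eq0 -lt0n.
Qed.

Let ZSS t : Z t.+2 = d%:R *: (Z t.+1 *m W) - k *: Z t.
Proof.
apply/rowP => j; rewrite [LHS]mxE deviationSS [RHS]mxE [X in _ = X + _]mxE.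
by rewrite mul_row_transition // mulrA divff ?mul1r ?mxE // pnatr_eq0 -lt0n.
Qed.

Let coord1 a w : W *m w = a *: w -> coord w 1 = (1 + d%:R * a) * coord w 0.
Proof.
move=> Ww; rewrite /coord Z1 mulmxDl -scalemxAl -mulmxA Ww -scalemxAr !mxE.
ring.
Qed.

Let coordSS a w t : W *m w = a *: w ->
  coord w t.+2 = d%:R * a * coord w t.+1 - k * coord w t.
Proof.
move=> Ww; rewrite /coord ZSS mulmxBl -!scalemxAl -mulmxA Ww -scalemxAr !mxE.
ring.
Qed.

Lemma deviation_bound mu : 0 <= mu -> 4 * k <= (d%:R * mu) ^+ 2 ->
  1 - abs_spectral_gap W <= mu ->
  exists2 B, 0 <= B &
    forall t, norm2 (deviation t) <= B * t.+1%:R * dom_root k (d%:R * mu) ^+ t.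
Proof.
move=> mu0 disc gap_mu.
have dmu0 : 0 <= d%:R * mu by rewrite mulr_ge0.
have rho0 := dom_root_gt0 k_gt0 dmu0 disc; set rho := dom_root _ _ in rho0 *.
have [P [D [P_unit PW]]] := symmetric_diagonalizable (transition_mx_sym R d e_sym).
(* The columns of [invmx P] are right eigenvectors, and pairing with them gives the coordinates of
   [Z t] in the basis of rows of [P]. *)
have WP : W *m invmx P = invmx P *m diag_mx D.
  by rewrite -[LHS](mulKmx P_unit) [P *m _]mulmxA PW mulmxK.
have eig i : W *m col i (invmx P) = D 0 i *: col i (invmx P).
  rewrite [in LHS]colE mulmxA WP -colE; apply/colP => j.
  by rewrite mul_mx_diag !mxE mulrC.
have coordE i t : coord (col i (invmx P)) t = (Z t *m invmx P) 0 i.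
  by rewrite /coord !mxE; apply: eq_bigr => j _; rewrite !mxE.
have coord_bound i : exists B, forall t,
    `|(Z t *m invmx P) 0 i| <= B * t.+1%:R * rho ^+ t.
  have Z0_sum : Z 0 *m (const_mx 1 : 'cV_#|V|) = 0.
    apply/matrixP => x y; rewrite !mxE sum_ord_card -[RHS]sum_deviation0.
    by apply: eq_bigr => v _; rewrite !mxE enum_rankK mulr1.
  have [Di|c0] := eigenvalue_gap_or_coord0 (transition_mx_ge0 R e d)
    (transition_mx_sum R e_sym e_reg d_gt0) P_unit PW Z0_sum i.
    have aD : `|d%:R * D 0 i| <= d%:R * mu.
      by rewrite normrM ger0_norm // ler_wpM2l // (le_trans Di).
    have [B HB] := recurrence_bound k_gt0 dmu0 disc aD (fun t => coordSS t (eig i)).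
    by exists B => t; rewrite -coordE HB.
  (* A vanishing initial coordinate forces the next one to vanish, hence all: two consecutive zeros
     propagate through the recurrence. *)
  exists 0 => t; rewrite !mul0r normr_le0 -coordE.
  suff : coord (col i (invmx P)) t = 0 /\ coord (col i (invmx P)) t.+1 = 0 by case=> ->.
  elim: t => [|t [IH0 IH1]]; last by rewrite (coordSS _ (eig i)) IH0 IH1 !mulr0 subr0.
  by rewrite (coord1 (eig i)) coordE c0 mulr0.
have [Bc HBc] := choice coord_bound.
exists (\sum_v \sum_i `|Bc i| * `|P i (enum_rank v)|).
  by rewrite sumr_ge0 // => v _; rewrite sumr_ge0 // => i _; rewrite mulr_ge0.
move=> t; apply: le_trans (norm2_le_sum _) _.
rewrite !mulr_suml; apply: ler_sum => v _.
have -> : deviation t v = (Z t *m invmx P *m P) 0 (enum_rank v).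
  by rewrite mulmxKV // mxE enum_rankK.
rewrite mxE (le_trans (ler_norm_sum _ _ _)) // !mulr_suml; apply: ler_sum => i _.
rewrite normrM.
have -> : `|Bc i| * `|P i (enum_rank v)| * t.+1%:R * rho ^+ t =
    `|Bc i| * t.+1%:R * rho ^+ t * `|P i (enum_rank v)| by ring.
rewrite ler_wpM2r // (le_trans (HBc i t)) // ler_wpM2r ?exprn_ge0 ?(ltW rho0) //.
by rewrite ler_wpM2r // ler_norm.
Qed.

Lemma mp_rate_le mu : 0 <= mu -> 4 * k <= (d%:R * mu) ^+ 2 ->
  1 - abs_spectral_gap W <= mu ->
  (mp_rate e xi <= (dom_root k (d%:R * mu) / k)%:E)%E.
Proof.
move=> mu0 disc gap_mu; have [B B0 HB] := deviation_bound mu0 disc gap_mu.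
have rho0 := dom_root_gt0 k_gt0 (mulr_ge0 (ler0n R d) mu0) disc.
apply: (@limn_esup_root_le _ _ B) => [|t]; first by rewrite divr_gt0.
rewrite norm2_ge0 /= norm2_error ler_pdivrMr ?mp_denom_gt0 //.
apply: le_trans (HB t) _; rewrite (expr_div_n _ k) -[leRHS]mulrA ler_wpM2l ?mulr_ge0 //.
rewrite -mulrA ler_peMr ?exprn_ge0 ?(ltW rho0) // mulrC ler_pdivlMr ?exprn_gt0 //.
by rewrite mul1r mp_denom_ge.
Qed.

(** The pairing with [u] is at most a constant times the norm, so the lower bound on this coordinate
    passes to the norm. The zero sum of [u] removes the mean, leaving the pairing of [u] with [xi]
    as initial value. *)
Lemma mp_rate_ge (a mu : R) (u : 'rV[R]_#|V|) :
  4 * k <= (d%:R * mu) ^+ 2 -> u *m W = a *: u -> `|a| = mu ->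
  \sum_v u 0 (enum_rank v) = 0 -> \sum_v u 0 (enum_rank v) * xi v != 0 ->
  ((dom_root k (d%:R * mu) / k)%:E <= mp_rate e xi)%E.
Proof.
move=> disc uW a_mu u_sum u_xi.
have mu0 : 0 <= mu by rewrite -a_mu.
have dmu0 : 0 <= d%:R * mu by rewrite mulr_ge0.
have rho0 := dom_root_gt0 k_gt0 dmu0 disc.
have rho2 := dom_root_sqr_ge k_gt0 dmu0 disc; set rho := dom_root _ _ in rho0 rho2 *.
(* [rho ^+ 2 >= k = d - 1 >= 2]. *)
have rho1 : 1 < rho.
  rewrite ltNge; apply/negP => rho_le1.
  have : rho ^+ 2 <= 1 by rewrite exprn_ile1 ?(ltW rho0).
  by move: rho2; rewrite /k; have := d3; lra.
have Wu : W *m u^T = a *: u^T.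
  by rewrite -[W](transition_mx_sym R d e_sym) -trmx_mul uW linearZ.
have coordE t : coord u^T t = \sum_v u 0 (enum_rank v) * deviation t v.
  rewrite /coord mxE sum_ord_card; apply: eq_bigr => v _.
  by rewrite !mxE enum_rankK mulrC.
have coord0 : coord u^T 0 = \sum_v u 0 (enum_rank v) * xi v.
  rewrite coordE; under eq_bigr do rewrite deviation0 mulrBr.
  by rewrite sumrB -mulr_suml u_sum mul0r subr0.
have lower := recurrence_lower_bound k_gt0 dmu0 disc rho1 _
  (fun t => coordSS t Wu) (coord1 Wu).
have {}lower := lower (_ : `|d%:R * a| = d%:R * mu); rewrite -/rho in lower.
have {}lower := lower (etrans (normrM _ _) (congr2 *%R (ger0_norm (ler0n R d)) a_mu)).
pose U : R := 1 + \sum_v `|u 0 (enum_rank v)|.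
have U0 : 0 < U by rewrite ltr_pwDl // sumr_ge0.
have upper t : `|coord u^T t| <= U * norm2 (deviation t).
  rewrite coordE (le_trans (ler_norm_sum _ _ _)) // mulrDl mul1r.
  rewrite -[leLHS]add0r lerD ?norm2_ge0 // mulr_suml; apply: ler_sum => v _.
  by rewrite normrM ler_wpM2l // norm_le_norm2.
(* The 3 comes from [mp_denom_le], the factor [U] from [upper]; the summand 1 in [U] makes it
   positive. *)
pose B := (rho - 1) / rho * `|coord u^T 0| / (3 * U).
apply: (@limn_esup_root_ge _ _ B) => [| |t].
- apply: divr_gt0; last exact: mulr_gt0.
  apply: mulr_gt0; last by rewrite normr_gt0 coord0.
  by apply: divr_gt0 => //; rewrite subr_gt0.
- by rewrite divr_gt0.
rewrite norm2_error ler_pdivlMr ?mp_denom_gt0 // -(ler_pM2l U0).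
apply: le_trans (upper t); apply: le_trans (lower t).
rewrite /B (expr_div_n _ k).
set X := (rho - 1) / rho * `|_|; have X0 : 0 <= X.
  by apply: mulr_ge0 => //; apply: divr_ge0; rewrite ?subr_ge0 ?(ltW rho1) ?(ltW rho0).
have kt : 0 < k ^+ t by rewrite exprn_gt0.
have -> : U * (X / (3 * U) * (rho ^+ t / k ^+ t) * mp_denom R d t) =
   X * rho ^+ t * (mp_denom R d t / (3 * k ^+ t)).
  by field; rewrite !gt_eqF.
apply: ler_piMr; first by apply: mulr_ge0 => //; rewrite exprn_ge0 ?(ltW rho0).
rewrite ler_pdivrMr ?mulr_gt0 // mul1r.
by apply: le_trans (mp_denom_le R d_ge3 t); rewrite lerDl.
Qed.

End Deviation.

(** * Closed form of the rate and the two regimes *)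

(** [1 - 4 (D - 1) / D^2] is the square of [(D - 2) / D], so the denominator on the right is
    [2 (D - 1) / D]. *)
Lemma dom_root_rate (R : rcfType) (D mu : R) : 3 <= D ->
  dom_root (D - 1) (D * mu) / (D - 1) =
  (mu + Num.sqrt (mu ^+ 2 - 4 * (D - 1) / D ^+ 2)) /
  (1 + Num.sqrt (1 - 4 * (D - 1) / D ^+ 2)).
Proof.
move=> D3; have D0 : D != 0 by rewrite gt_eqF //; lra.
have D2 : 0 <= (D - 2) / D by rewrite divr_ge0; lra.
have -> : 1 - 4 * (D - 1) / D ^+ 2 = ((D - 2) / D) ^+ 2 by field.
rewrite sqrtr_sqr ger0_norm // /dom_root.
have -> : (D * mu) ^+ 2 - 4 * (D - 1) = D ^+ 2 * (mu ^+ 2 - 4 * (D - 1) / D ^+ 2).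
  by field.
rewrite sqrtrM ?sqr_ge0 // sqrtr_sqr ger0_norm; last by lra.
by field; rewrite D0 !gt_eqF //; lra.
Qed.

(** When [gap = 0] the all-ones vector is an eigenvector of magnitude [1 - gap]. It pairs
    nontrivially with nonzero constant observations, whose error vanishes; the zero-sum condition on
    [u] excludes this case. *)
Theorem theorem9p3 (R : realType) (d : nat) (hd : (3 <= d)%N)
    (V : finType) (e : rel V) (hG : simple_graph e) (hreg : regular_graph e d)
    (xi : V -> R) :
  let W := transition_mx R e d in
  let gap := abs_spectral_gap W in
  let q : R := 4 * (d%:R - 1) / d%:R ^+ 2 in
  let r : R := 2 * Num.sqrt (d%:R - 1) / d%:R in
  let bound1 : R :=
    ((1 - gap) + Num.sqrt ((1 - gap) ^+ 2 - q)) / (1 + Num.sqrt (1 - q)) in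
  let bound2 : R := r / (1 + Num.sqrt (1 - q)) in
  (gap < 1 - r ->
     (mp_rate e xi <= bound1%:E)%E /\
     ((exists (a : R) (u : 'rV[R]_#|V|),
         [/\ u != 0, u *m W = a *: u, `|a| = 1 - gap,
             \sum_(v : V) u 0 (enum_rank v) * xi v != 0 &
             gap = 0 -> \sum_(v : V) u 0 (enum_rank v) = 0]) ->
      mp_rate e xi = bound1%:E)) /\
  (1 - r <= gap -> (mp_rate e xi <= bound2%:E)%E).
Proof.
move=> W gap q r bound1 bound2; have [e_sym _] := hG.
have d3 : 3 <= d%:R :> R by rewrite ler_nat.
have d0 : d%:R != 0 :> R by rewrite gt_eqF //; lra.
have r0 : 0 <= r by rewrite divr_ge0 // mulr_ge0 // sqrtr_ge0.
(* [r] is the value of [mu] at which the discriminant vanishes. *)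
have dr : (d%:R * r) ^+ 2 = 4 * (d%:R - 1).
  rewrite /r mulrCA divff // mulr1 exprMn sqr_sqrtr; last by lra.
  by rewrite expr2 -natrM.
have rate_le mu : r <= mu -> 1 - gap <= mu ->
    (mp_rate e xi <= ((mu + Num.sqrt (mu ^+ 2 - q)) / (1 + Num.sqrt (1 - q)))%:E)%E.
  move=> r_mu gap_mu; rewrite -dom_root_rate //.
  apply: mp_rate_le => //; first exact: le_trans r_mu.
  by rewrite -dr ler_sqr ?nnegrE ?mulr_ge0 ?ler_wpM2l // (le_trans r0).
split=> [gap_r|gap_r]; last first.
  have rq : r ^+ 2 = q by rewrite /q -dr; field.
  have := rate_le r (lexx r); rewrite rq subrr sqrtr0 addr0; apply.
  by lra.
have r_mu : r <= 1 - gap by lra.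
have upper := rate_le _ r_mu (lexx _).
split=> // -[a [u [_ uW a_mu u_xi gap0]]].
apply/eqP; rewrite eq_le upper /= /bound1 -dom_root_rate //.
apply: (mp_rate_ge _ _ _ _ uW a_mu _ u_xi) => //.
  by rewrite -dr ler_sqr ?nnegrE ?mulr_ge0 ?ler_wpM2l // (le_trans r0).
(* [a = 1] forces [gap = 0], where the zero sum is assumed. Otherwise [W] fixes the all-ones vector,
   so the sum of [u] equals [a] times itself and is 0. *)
have [a1|a1] := eqVneq a 1; first by apply: gap0; move: a_mu; rewrite a1 normr1; lra.
have d_gt0 : (0 < d)%N by apply: leq_trans hd.
have : (u *m W) *m (const_mx 1 : 'cV_#|V|) = u *m const_mx 1.
  by rewrite -mulmxA (transition_mx_sum R e_sym hreg d_gt0).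
rewrite uW -scalemxAl => /matrixP/(_ 0 0); rewrite mxE.
have -> : (u *m (const_mx 1 : 'cV_#|V|)) 0 0 = \sum_v u 0 (enum_rank v).
  by rewrite mxE sum_ord_card; apply: eq_bigr => v _; rewrite mxE mulr1.
move=> /eqP; rewrite -subr_eq0 -[X in _ - X]mul1r -mulrBl mulf_eq0 subr_eq0.
by rewrite (negbTE a1) => /eqP.
Qed.
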